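(* Let $n\geqslant 1$. Every $\bigstar$-involutive $n$-valued group of order $3$, on a set $X=\{e,x_1,x_2\}$ with unit $e$, has as its matrix $B$ (the $4\times 3$ matrix whose rows list, in order, the multiplicities of $(e,x_1,x_2)$ in $x_1\ast x_1$, $x_1\ast x_2$, $x_2\ast x_1$, $x_2\ast x_2$) one of the following: $$\widetilde B_1=\begin{pmatrix} m(x_1)&a(x_1)&n-m(x_1)-a(x_1)\\ 0&a(x_1,x_2)&n-a(x_1,x_2)\\ 0&a(x_1,x_2)&n-a(x_1,x_2)\\ m(x_2)&a(x_2)&n-m(x_2)-a(x_2)\end{pmatrix},$$ or $$\widetilde B_2=\begin{pmatrix}0&a(x_1)&n-a(x_1)\\ n-2a(x_1)&a(x_1)&a(x_1)\\ n-2a(x_1)&a(x_1)&a(x_1)\\ 0&n-a(x_1)&a(x_1)\end{pmatrix},$$ where $$a(x_1,x_2)=r\bigl(n-m(x_1)-a(x_1)\bigr),\qquad a(x_2)=r\bigl(n-a(x_1,x_2)\bigr),\qquad r=\frac{m(x_2)}{m(x_1)},$$ and $m(x_1)$, $m(x_2)$, $a(x_1)$ are free parameters.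
   Context: $\mathrm{Sym}^n(X)=X^{n}/S_n$ is the set of $n$-element multisets of elements of $X$; a multiset is written as a formal sum $\sum_{x\in X} m_x\, x$ with non-negative integer multiplicities summing to $n$. All matrix entries are multiplicities, hence non-negative integers. The formulas involving $r$ concern $\widetilde B_1$ only (where $m(x_1)\ne0$). An $n$-valued monoid is a set $X$ with an operation $\ast:X\times X\to \mathrm{Sym}^n(X)$ such that: (associativity) for all $x,y,z\in X$ the $n^2$-multisets $[x\ast w\mid w\in y\ast z]$ and $[w\ast z\mid w\in x\ast y]$ coincide (with $w$ running with multiplicity); (unit) there is $e\in X$ with $e\ast x=x\ast e=[x,\dots,x]$ ($n$ times) for every $x\in X$. Its order is $|X|$. An $n$-valued group is an $n$-valued monoid equipped with a map $\mathrm{inv}:X\to X$ such that $e\in x\ast \mathrm{inv}(x)$ and $e\in \mathrm{inv}(x)\ast x$ for every $x\in X$. An $n$-valued group $(X,\ast,\mathrm{inv})$ is $\bigstar$-involutive if $\mathrm{inv}$ is an involution such that: (i) for any $x\in X$, $e\in x\ast y$ if and only if $y=\mathrm{inv}(x)$; (ii) $m(x)=m(\mathrm{inv}(x))$, where $m(x)$ is the multiplicity of $e$ in $x\ast\mathrm{inv}(x)$; (iii) $\mathrm{inv}(x\ast y)=\mathrm{inv}(y)\ast\mathrm{inv}(x)$ for all $x,y\in X$ ($\mathrm{inv}$ being applied elementwise to multisets). In the matrices $\widetilde B_1,\widetilde B_2$ the symbols $m(x_1),m(x_2),a(x_1)$ are used as names of parameters. *)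

(* Defs.v *)
From mathcomp Require Import all_boot all_order all_algebra.
From mathcomp Require Export finmap multiset.

Set Implicit Arguments.
Unset Strict Implicit.
Unset Printing Implicit Defensive.

Import GRing.Theory Num.Theory.

Local Open Scope mset_scope.
Local Open Scope ring_scope.

(* [sym_mset A x] is the multiplicity of [x] in [A]; coerced to [seq X], [A]
   is the list of its elements repeated according to multiplicity. *)
Record Sym (n : nat) (X : choiceType) := MkSym {
  sym_mset :> {mset X};
  sym_size : size sym_mset == n
}.

Section NValued.

Variables (n : nat) (X : choiceType).
Implicit Types (op : X -> X -> Sym n X) (e x y z : X) (inv : X -> X).

(* Both sides have size [n ^ 2]; [w] runs over its multiset with
   multiplicity. *)
Definition nvalued_assoc op := forall x y z,
  seq_mset (flatten [seq (op x w : seq X) | w <- op y z]) =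
  seq_mset (flatten [seq (op w z : seq X) | w <- op x y]).

Definition nvalued_unit op e := forall x,
  sym_mset (op e x) = msetn n x /\ sym_mset (op x e) = msetn n x.

Definition nvalued_monoid op e := nvalued_assoc op /\ nvalued_unit op e.

Definition nvalued_group op e inv :=
  nvalued_monoid op e /\
  (forall x, e \in sym_mset (op x (inv x)) /\ e \in sym_mset (op (inv x) x)).

Definition inv_mult op e inv x : nat :=
  sym_mset (op x (inv x)) e.

Definition star_involutive op e inv :=
  [/\ nvalued_group op e inv,
      involutive inv,
      forall x y, e \in sym_mset (op x y) <-> y = inv x,
      forall x, inv_mult op e inv x = inv_mult op e inv (inv x)
    & forall x y,
        seq_mset [seq inv w | w <- op x y] = sym_mset (op (inv y) (inv x))].

Definition matrixB op e x1 x2 : 'M[nat]_(4, 3) :=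
  \matrix_(i < 4, j < 3)
    let A := nth (op x1 x1) [:: op x1 x1; op x1 x2; op x2 x1; op x2 x2] i in
    sym_mset A (nth e [:: e; x1; x2] j).

End NValued.

Definition mx_of_rows p q (s : seq (seq rat)) : 'M[rat]_(p, q) :=
  \matrix_(i < p, j < q) nth 0 (nth [::] s i) j.

(* The entries are computed in [rat], so that subtraction and the quotient [r]
   are the genuine ones; [m1] is the divisor and must be nonzero. *)
Definition matrixB1 (n m1 m2 a1 : nat) : 'M[rat]_(4, 3) :=
  let r := m2%:R / m1%:R in
  let a12 := r * (n%:R - m1%:R - a1%:R) in
  let a2 := r * (n%:R - a12) in
  mx_of_rows 4 3
    [:: [:: m1%:R; a1%:R; n%:R - m1%:R - a1%:R];
        [:: 0;     a12;   n%:R - a12          ];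
        [:: 0;     a12;   n%:R - a12          ];
        [:: m2%:R; a2;    n%:R - m2%:R - a2   ]].

Definition matrixB2 (n a1 : nat) : 'M[rat]_(4, 3) :=
  mx_of_rows 4 3
    [:: [:: 0;                   a1%:R;         n%:R - a1%:R];
        [:: n%:R - 2%:R * a1%:R; a1%:R;         a1%:R       ];
        [:: n%:R - 2%:R * a1%:R; a1%:R;         a1%:R       ];
        [:: 0;                   n%:R - a1%:R;  a1%:R       ]].

Definition mx_natr p q (B : 'M[nat]_(p, q)) : 'M[rat]_(p, q) :=
  map_mx (fun k : nat => k%:R) B.

(* Main.v *)
From mathcomp Require Import perm.
Require Import Defs.
From mathcomp Require Import all_boot all_order all_algebra.
From mathcomp Require Import zify ring lra.

(** Extending [op] bilinearly turns an n-valued monoid into an associative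
    algebra on the span of [X], in which [e] acts as [n] times the identity; the
    multiplicities are its structure constants, and associativity is a family of
    polynomial equations between them ([nvalued_assocP]).

    The map [inv] fixes [e], so on [{e, x1, x2}] it is either the identity or the
    exchange of [x1] and [x2].
    - If it is the identity, the anti-automorphism axiom says that [op] is
      commutative, and [e] occurs in [x1 * x1] and [x2 * x2] but not in
      [x1 * x2]. Comparing the multiplicities of [e] in the two bracketings of
      [x1 x1 x2] and of [x1 x2 x2] gives the two relations that contain [r]
      ([star_involutive_B1]).
    - If it is the exchange, [e] occurs only in the mixed products. By the
      symmetry under [inv] and the size [n] of each product, the table is
      determined by the multiplicities of [x1] in [x1 * x1] and in [x1 * x2];
      comparing the multiplicities of [e] in the two bracketings of [x1 x1 x2]
      shows that these are equal ([star_involutive_B2]).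

    Conversely, let a commutative table with unit be given. In a commutative
    algebra the associativity equation for [x, y, z] is the one for [z, y, x],
    and it is void for [x, y, x]; so only the triples [x1 x1 x2] and [x1 x2 x2]
    matter. For each of them both bracketings are multisets of the same size
    [n ^ 2], so equality of the multiplicities of [e] and of one other element is
    enough ([comm_op_assoc]). For the first family the equations at [e] are the
    two relations with [r], and the equations at [x1] and [x2] follow from these
    by eliminating [m(x1)]: this reflects the total symmetry of the trilinear form
    sending [x, y, z] to the multiplicity of [e] in [x y z]. For the second family
    the equations are polynomial identities in [n] and [a(x1)]. *)

Set Implicit Arguments.
Unset Strict Implicit.
Unset Printing Implicit Defensive.

Import GRing.Theory Num.Theory.

Local Open Scope mset_scope.
Local Open Scope nat_scope.

(** * Associativity in terms of multiplicities *)

Section Multiplicities.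

Variables (n : nat) (X : finType).
Implicit Types (op : X -> X -> Sym n X) (e x y z t : X) (A : Sym n X).

Lemma sum_count (s : seq X) (F : X -> nat) :
  \sum_(w <- s) F w = \sum_w count_mem w s * F w.
Proof.
elim: s => [|a s IHs]; first by rewrite big_nil big1.
rewrite big_cons IHs; under [RHS]eq_bigr do rewrite mulnDl.
rewrite big_split /=; congr (_ + _).
rewrite (bigD1 a) //= eqxx mul1n big1 ?addn0 // => w wNa.
by rewrite eq_sym (negPf wNa).
Qed.

Lemma sum_mult A : \sum_t sym_mset A t = n.
Proof.
rewrite -[RHS](eqP (sym_size A)) -sum1_size [RHS]sum_count.
by apply: eq_bigr => t _; rewrite count_mem_mset muln1.
Qed.

Lemma mult_flatten A (F : X -> Sym n X) t :
  seq_mset (flatten [seq (F w : seq X) | w <- A]) t =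
  \sum_w sym_mset A w * sym_mset (F w) t.
Proof.
rewrite mset_seqE count_flatten sumn_map big_map sum_count.
by apply: eq_bigr => w _; rewrite /= !count_mem_mset.
Qed.

Definition assoc_at op x y z t :=
  \sum_w sym_mset (op y z) w * sym_mset (op x w) t =
  \sum_w sym_mset (op x y) w * sym_mset (op w z) t.

Lemma nvalued_assocP op :
  nvalued_assoc op <-> (forall x y z t, assoc_at op x y z t).
Proof.
split=> opA x y z => [t|].
  by have /msetP/(_ t) := opA x y z; rewrite !mult_flatten.
by apply/msetP => t; rewrite !mult_flatten opA.
Qed.

(** Either bracketing of a triple product has [n ^ 2] elements, whatever [op]
    is: this is what makes one associativity equation per triple redundant. *)
Lemma sum_mult_comp A (F : X -> Sym n X) :
  \sum_t \sum_w sym_mset A w * sym_mset (F w) t = n * n.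
Proof.
rewrite exchange_big /=; under eq_bigr do rewrite -big_distrr /= sum_mult.
by rewrite -big_distrl /= sum_mult.
Qed.

Lemma mult_map_inv (inv : X -> X) A t : involutive inv ->
  seq_mset [seq inv w | w <- A] t = sym_mset A (inv t).
Proof.
move=> invK; rewrite mset_seqE count_map -count_mem_mset.
by apply: eq_count => w /=; rewrite (can2_eq invK invK).
Qed.

(** Reversing the factors exchanges the two bracketings. *)
Lemma assoc_at_comm op x y z t : (forall u v, op u v = op v u) ->
  assoc_at op x y z t -> assoc_at op z y x t.
Proof.
move=> opC; rewrite /assoc_at (opC z y) (opC y x) => xyz.
under eq_bigr do rewrite (opC z); rewrite -xyz.
by apply: eq_bigr => w _; rewrite (opC x w).
Qed.

Lemma sum_unit (F : X -> nat) x : \sum_w msetn n x w * F w = n * F x.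
Proof.
rewrite (bigD1 x) //= msetnxx big1 ?addn0 // => w wNx.
by rewrite msetnE (negPf wNx).
Qed.

Lemma sum_pure A t : \sum_w sym_mset A w * msetn n w t = n * sym_mset A t.
Proof.
rewrite (bigD1 t) //= msetnxx mulnC big1 ?addn0 // => w wNt.
by rewrite msetnE eq_sym (negPf wNt) muln0.
Qed.

Lemma assoc_at_unit op e x y z t : nvalued_unit op e ->
  [|| x == e, y == e | z == e] -> assoc_at op x y z t.
Proof.
move=> opU; rewrite /assoc_at.
have opeE u : sym_mset (op e u) = msetn n u by case: (opU u).
have oeE u : sym_mset (op u e) = msetn n u by case: (opU u).
case/or3P => /eqP->.
- under eq_bigr do rewrite opeE.
  by rewrite sum_pure opeE sum_unit.
- by rewrite opeE oeE !sum_unit.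
- under [RHS]eq_bigr do rewrite oeE.
  by rewrite sum_pure oeE sum_unit.
Qed.

Lemma size_msetn x : size (msetn n x : seq X) == n.
Proof. by rewrite enum_msetn size_nseq. Qed.

Definition pure x : Sym n X := MkSym (size_msetn x).

End Multiplicities.

(** * The two families as matrices of natural numbers *)

Definition rows_mx (s : seq (seq nat)) : 'M[nat]_(4, 3) :=
  (\matrix_(i, j) nth 0 (nth [::] s i) j)%R.

(** The rational formulas of the first family with denominators cleared; the
    entries given there by subtraction become unknowns constrained by the row
    sums. *)
Definition is_B1 n m1 m2 a1 (B : 'M[nat]_(4, 3)) :=
  exists b1 a12 b12 a2 b2,
    [/\ B = rows_mx [:: [:: m1; a1; b1]; [:: 0; a12; b12];
                        [:: 0; a12; b12]; [:: m2; a2; b2]],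
        [/\ m1 + a1 + b1 = n, 0 + a12 + b12 = n & m2 + a2 + b2 = n],
        m1 * a12 = m2 * b1 & m1 * a2 = m2 * b12].

(** The row sums are written with the entry of [e] first, in the form in which
    they certify the size of a multiset below. *)
Definition is_B2 n a (B : 'M[nat]_(4, 3)) :=
  exists m b,
    [/\ B = rows_mx [:: [:: 0; a; b]; [:: m; a; a]; [:: m; a; a]; [:: 0; b; a]],
        m + a + a = n, 0 + a + b = n & 0 + b + a = n].

Section Entries.
Local Open Scope ring_scope.

Lemma natrQ_inj (p q : nat) : p%:R = q%:R :> rat -> p = q.
Proof. by move/eqP; rewrite eqr_nat => /eqP. Qed.

Lemma mx43_rows (B : 'M[nat]_(4, 3)) :
  let b k l := B (inord k) (inord l) in
  B = rows_mx [:: [:: b 0 0; b 0 1; b 0 2]; [:: b 1 0; b 1 1; b 1 2];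
                  [:: b 2 0; b 2 1; b 2 2]; [:: b 3 0; b 3 1; b 3 2]]%N.
Proof.
apply/matrixP => i j; rewrite mxE; case: i j => [[|[|[|[]]]] ?] // [[|[|[|]]] ?] //=.
all: by congr (B _ _); apply: val_inj; rewrite /= inordK.
Qed.

Lemma matrixB1P n m1 m2 a1 B : (0 < m1)%N ->
  mx_natr B = matrixB1 n m1 m2 a1 <-> is_B1 n m1 m2 a1 B.
Proof.
move=> m1_gt0; have m1_neq0 : m1%:R != 0 :> rat by rewrite pnatr_eq0 -lt0n.
split=> [BE | [b1 [a12 [b12 [a2 [b2 [-> [n1 n12 n2] e12 e2]]]]]]].
  have E k l (hk : (k < 4)%N) (hl : (l < 3)%N) :
      (B (inord k) (inord l))%:R = matrixB1 n m1 m2 a1 (inord k) (inord l).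
    by rewrite -BE mxE.
  have := (E 0%N 0%N isT isT, E 0%N 1%N isT isT, E 0%N 2%N isT isT,
           E 1%N 0%N isT isT, E 1%N 1%N isT isT, E 1%N 2%N isT isT,
           E 2%N 0%N isT isT, E 2%N 1%N isT isT, E 2%N 2%N isT isT,
           E 3%N 0%N isT isT, E 3%N 1%N isT isT, E 3%N 2%N isT isT).
  rewrite !mxE !inordK //= => -[[[[[[[[[[[]]]]]]]]]]].
  move=> /natrQ_inj e00 /natrQ_inj e01 e02 /(natrQ_inj (q := 0)) e10 e11 e12.
  rewrite -e12 -e11 => /(natrQ_inj (q := 0)) e20 /natrQ_inj e21 /natrQ_inj e22.
  move=> /natrQ_inj e30 e31 e32.
  exists (B (inord 0) (inord 2)), (B (inord 1) (inord 1)).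
  exists (B (inord 1) (inord 2)), (B (inord 3) (inord 1)).
  exists (B (inord 3) (inord 2)); split.
  - by rewrite {1}[B]mx43_rows e00 e01 e10 e20 e21 e22 e30.
  - split; apply: natrQ_inj; rewrite !natrD ?e02 ?e12 ?e32; lra.
  - by apply: natrQ_inj; rewrite !natrM e11 e02; field.
  - by apply: natrQ_inj; rewrite !natrM e31 e12 -e11; field.
have h12 : a12%:R = m2%:R / m1%:R * (n%:R - m1%:R - a1%:R) :> rat.
  apply: (mulfI m1_neq0); rewrite -natrM e12 -n1 !natrD natrM; by field.
have h2 : a2%:R = m2%:R / m1%:R * (n%:R - a12%:R) :> rat.
  apply: (mulfI m1_neq0); rewrite -natrM e2 -n12 !natrD natrM; by field.
have n1R : n%:R = m1%:R + a1%:R + b1%:R :> rat by rewrite -n1 !natrD.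
have n12R : n%:R = a12%:R + b12%:R :> rat by rewrite -n12 !natrD add0r.
have n2R : n%:R = m2%:R + a2%:R + b2%:R :> rat by rewrite -n2 !natrD.
apply/matrixP=> i j; rewrite !mxE.
by case: i j => [[|[|[|[]]]] ?] // [[|[|[|]]] ?] //=; rewrite -?h12 -?h2; lra.
Qed.

Lemma matrixB2P n a B :
  mx_natr B = matrixB2 n a <-> is_B2 n a B.
Proof.
split=> [BE | [m [b [-> nm nab _]]]].
  have E k l (hk : (k < 4)%N) (hl : (l < 3)%N) :
      (B (inord k) (inord l))%:R = matrixB2 n a (inord k) (inord l).
    by rewrite -BE mxE.
  have := (E 0%N 0%N isT isT, E 0%N 1%N isT isT, E 0%N 2%N isT isT,
           E 1%N 0%N isT isT, E 1%N 1%N isT isT, E 1%N 2%N isT isT,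
           E 2%N 0%N isT isT, E 2%N 1%N isT isT, E 2%N 2%N isT isT,
           E 3%N 0%N isT isT, E 3%N 1%N isT isT, E 3%N 2%N isT isT).
  rewrite !mxE !inordK //= => -[[[[[[[[[[[]]]]]]]]]]].
  move=> /(natrQ_inj (q := 0)) e00 /natrQ_inj e01 e02 e10 /natrQ_inj e11 /natrQ_inj e12.
  rewrite -e10 -e02 => /natrQ_inj e20 /natrQ_inj e21 /natrQ_inj e22.
  move=> /(natrQ_inj (q := 0)) e30 /natrQ_inj e31 /natrQ_inj e32.
  exists (B (inord 1) (inord 0)), (B (inord 0) (inord 2)); split.
  - by rewrite {1}[B]mx43_rows e00 e01 e11 e12 e20 e21 e22 e30 e31 e32.
  - by apply: natrQ_inj; rewrite !natrD e10; lra.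
  - by apply: natrQ_inj; rewrite !natrD e02; lra.
  - by apply: natrQ_inj; rewrite !natrD e02; lra.
have nmR : n%:R = m%:R + a%:R + a%:R :> rat by rewrite -nm !natrD.
have nabR : n%:R = a%:R + b%:R :> rat by rewrite -nab !natrD add0r.
apply/matrixP=> i j; rewrite !mxE.
by case: i j => [[|[|[|[]]]] ?] // [[|[|[|]]] ?] //=; lra.
Qed.

End Entries.

(** * Three elements *)

Section OrderThree.

Variables (n : nat) (X : finType) (e x1 x2 : X).
Hypotheses (n_gt0 : 0 < n) (cardX : #|X| = 3) (uniqX : uniq [:: e; x1; x2]).
Implicit Types (op : X -> X -> Sym n X) (inv : X -> X) (t : X) (A : Sym n X).

Lemma mem3 t : t \in [:: e; x1; x2].
Proof.
have cardE : #|[:: e; x1; x2]| = #|X| by rewrite (card_uniqP uniqX).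
by rewrite (subset_cardP cardE (subset_predT _)).
Qed.

Lemma elt3 t : [\/ t = e, t = x1 | t = x2].
Proof. by have:= mem3 t; rewrite !inE => /or3P[]/eqP; constructor. Qed.

Lemma neq3 : ((e == x1 = false) * (e == x2 = false) * (x1 == x2 = false) *
  (x1 == e = false) * (x2 == e = false) * (x2 == x1 = false))%type.
Proof.
move: uniqX; rewrite /= !inE negb_or !andbT => /andP[/andP[/negPf a /negPf b]].
by move/negPf => c; rewrite !(eq_sym _ e) !(eq_sym x2) a b c.
Qed.

Lemma sum3 (F : X -> nat) : \sum_t F t = F e + F x1 + F x2.
Proof.
have -> : \sum_t F t = \sum_(t <- [:: e; x1; x2]) F t.
  apply: perm_big; apply: uniq_perm; rewrite ?index_enum_uniq // => t.
  by rewrite mem3 mem_index_enum.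
by rewrite !big_cons big_nil addn0 addnA.
Qed.

Lemma mult3 A : sym_mset A e + sym_mset A x1 + sym_mset A x2 = n.
Proof. by have := sum_mult A; rewrite sum3. Qed.

Definition mults A : seq nat := [seq sym_mset A t | t <- [:: e; x1; x2]].

Lemma matrixB_rows op : matrixB op e x1 x2 =
  rows_mx [seq mults A | A <- [:: op x1 x1; op x1 x2; op x2 x1; op x2 x2]].
Proof.
apply/matrixP => i j; rewrite !mxE.
by case: i j => [[|[|[|[]]]] ?] // [[|[|[|]]] ?].
Qed.

(** * Every table belongs to one of the families *)

(** The associativity equation, with the products by [e] already evaluated. *)
Lemma assoc3 op x y z t : nvalued_monoid op e ->
  sym_mset (op y z) e * msetn n x t +
  sym_mset (op y z) x1 * sym_mset (op x x1) t +
  sym_mset (op y z) x2 * sym_mset (op x x2) t =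
  sym_mset (op x y) e * msetn n z t +
  sym_mset (op x y) x1 * sym_mset (op x1 z) t +
  sym_mset (op x y) x2 * sym_mset (op x2 z) t.
Proof.
move=> [/nvalued_assocP/(_ x y z t) + opU].
rewrite /assoc_at !sum3.
by have [_ ->] := opU x; have [-> _] := opU z.
Qed.

Lemma inv_unit op inv : star_involutive op e inv -> inv e = e.
Proof.
case=> -[[_ opU] _] _ invE _ _; apply/esym/invE.
by have [-> _] := opU e; rewrite in_msetn n_gt0 eqxx.
Qed.

(** For [inv] the identity, the two relations are associativity of
    [x1 x1 x2] and of [x1 x2 x2] at [e]. *)
Lemma star_involutive_B1 op inv : star_involutive op e inv -> inv x1 = x1 ->
  exists m1 m2 a1,
    [/\ 0 < m1, 0 < m2 & is_B1 n m1 m2 a1 (matrixB op e x1 x2)].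
Proof.
move=> opS inv1; have inve := inv_unit opS.
case: opS => -[opM _] invK opE _ opI.
have inv2 : inv x2 = x2.
  case: (elt3 (inv x2)) => // /(congr1 inv); rewrite invK ?inve ?inv1 => /eqP;
  by rewrite neq3.
have invI t : inv t = t by case: (elt3 t) => ->.
have op21 : sym_mset (op x2 x1) = sym_mset (op x1 x2).
  by apply/msetP=> t; rewrite -[in RHS](invI t) -mult_map_inv // opI !invI.
have mult_e x y : (0 < sym_mset (op x y) e) = (y == x).
  by rewrite -in_mset; apply/idP/eqP; rewrite opE invI.
have e12 : sym_mset (op x1 x2) e = 0.
  by apply/eqP; rewrite -leqn0 leqNgt mult_e neq3.
exists (sym_mset (op x1 x1) e), (sym_mset (op x2 x2) e), (sym_mset (op x1 x1) x1).
rewrite !mult_e !eqxx; split=> //; rewrite matrixB_rows /mults /= op21 e12.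
exists (sym_mset (op x1 x1) x2), (sym_mset (op x1 x2) x1), (sym_mset (op x1 x2) x2).
exists (sym_mset (op x2 x2) x1), (sym_mset (op x2 x2) x2).
split=> //; first by split; rewrite ?mult3 //; have := mult3 (op x1 x2); rewrite e12.
  have := assoc3 x1 x1 x2 e opM; rewrite !msetnE !neq3 e12 !muln0 ?addn0 ?add0n => as1.
  by rewrite mulnC as1 mulnC.
have := assoc3 x1 x2 x2 e opM; rewrite !msetnE !neq3 e12 !muln0 ?addn0 ?add0n => as2.
by rewrite mulnC as2 mulnC.
Qed.

(** For [inv] the exchange, associativity of [x1 x1 x2] at [e] reads
    [c * m = a * m] with [m] positive, where [a] and [c] are the multiplicities of
    [x1] in [x1 * x1] and in [x1 * x2]. *)
Lemma star_involutive_B2 op inv : star_involutive op e inv -> inv x1 = x2 ->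
  exists a, 2 * a < n /\ is_B2 n a (matrixB op e x1 x2).
Proof.
move=> opS inv1; have inve := inv_unit opS.
case: opS => -[opM _] invK opE invm opI.
have inv2 : inv x2 = x1 by rewrite -inv1 invK.
have multI x y t : sym_mset (op (inv y) (inv x)) t = sym_mset (op x y) (inv t).
  by rewrite -opI mult_map_inv.
have mult_e x y : (0 < sym_mset (op x y) e) = (y == inv x).
  by rewrite -in_mset; apply/idP/eqP; rewrite opE.
have e11 : sym_mset (op x1 x1) e = 0.
  by apply/eqP; rewrite -leqn0 leqNgt mult_e inv1 neq3.
have e22 : sym_mset (op x2 x2) e = 0.
  by apply/eqP; rewrite -leqn0 leqNgt mult_e inv2 neq3.
have e12 : 0 < sym_mset (op x1 x2) e by rewrite mult_e inv1.
have e21 : sym_mset (op x2 x1) e = sym_mset (op x1 x2) e.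
  by have := invm x1; rewrite /inv_mult inv1 inv2.
have := multI x1 x1 x1; have := multI x1 x1 x2.
have := multI x1 x2 x1; have := multI x2 x1 x1; rewrite !inv1 !inv2.
move=> c21 c12 c1 c2.
have := assoc3 x1 x1 x2 e opM; rewrite !msetnE !neq3 e11.
have := mult3 (op x1 x2); have := mult3 (op x2 x1).
have := mult3 (op x1 x1); have := mult3 (op x2 x2).
rewrite c1 c2 -c12 -c21 e22 e11 e21 => n22 n11 n21 n12.
rewrite !muln0 !addn0 !add0n => /eqP; rewrite (eqn_pmul2r e12) => /eqP ca.
have da : sym_mset (op x2 x1) x1 = sym_mset (op x1 x1) x1.
  by rewrite -ca; move: n12 n21; clear; lia.
exists (sym_mset (op x1 x1) x1).
split; first by move: e12 n12; rewrite ca; clear; lia.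
exists (sym_mset (op x1 x2) e), (sym_mset (op x1 x1) x2).
split=> //; last by rewrite -ca.
by rewrite matrixB_rows /mults /= e11 e22 e21 -c21 -c12 c1 c2 ca da.
Qed.

(** * Every matrix of the families is realized *)

Definition mset3 (p q r : nat) : {mset X} :=
  (msetn p e `+` msetn q x1 `+` msetn r x2)%mset.

Lemma mset3E p q r :
  ((mset3 p q r e = p) * (mset3 p q r x1 = q) * (mset3 p q r x2 = r))%type.
Proof. by rewrite !msetE2 !msetnE !eqxx !neq3 !addn0 !add0n. Qed.

Lemma size_mset3 p q r : p + q + r = n -> size (mset3 p q r : seq X) == n.
Proof.
move=> <-; rewrite -sum1_size sum_count sum3 !count_mem_mset !muln1.
by rewrite !mset3E.
Qed.

Definition sym3 p q r (pqr : p + q + r = n) : Sym n X :=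
  MkSym (size_mset3 pqr).

(** Both sides have the same total over the three coefficients, so two equal
    coefficients force the third. *)
Lemma assoc_at_two op x y z u : u != e ->
  assoc_at op x y z e -> assoc_at op x y z u -> forall t, assoc_at op x y z t.
Proof.
have := sum_mult_comp (op x y) (fun w => op w z).
rewrite -(sum_mult_comp (op y z) (op x)) /assoc_at ![\sum_t \sum_w _]sum3.
move=> sumE uNe xyze xyzu t.
by case: (elt3 u) uNe xyzu => ->; rewrite ?eqxx //; case: (elt3 t) => ->; lia.
Qed.

Definition comm_op (A11 A12 A22 : Sym n X) (x y : X) : Sym n X :=
  if x == e then pure n y else if y == e then pure n x else
  if x != y then A12 else if x == x1 then A11 else A22.

Lemma comm_opE A11 A12 A22 (op := comm_op A11 A12 A22) :
  ((op x1 x1 = A11) * (op x1 x2 = A12) * (op x2 x1 = A12) * (op x2 x2 = A22))%type.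
Proof. by rewrite /op /comm_op !neq3 !eqxx. Qed.

Lemma comm_op_unit A11 A12 A22 : nvalued_unit (comm_op A11 A12 A22) e.
Proof.
move=> x; rewrite /comm_op eqxx; split=> //.
by case: eqP => [->|_].
Qed.

Lemma comm_opC A11 A12 A22 x y :
  comm_op A11 A12 A22 x y = comm_op A11 A12 A22 y x.
Proof.
by rewrite /comm_op; case: (elt3 x) => ->; case: (elt3 y) => ->;
  rewrite ?neq3 ?eqxx.
Qed.

(** The eight triples of non-units reduce, by reversal and by commutativity, to
    two; each of these needs two coefficients, and the second one is chosen to give
    the simplest equation. *)
Lemma comm_op_assoc A11 A12 A22 (op := comm_op A11 A12 A22) :
  assoc_at op x1 x1 x2 e -> assoc_at op x1 x1 x2 x1 ->
  assoc_at op x1 x2 x2 e -> assoc_at op x1 x2 x2 x2 ->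
  nvalued_assoc op.
Proof.
move=> a112e a112x a122e a122x.
have opC : forall u v, op u v = op v u by exact: comm_opC.
have opU : nvalued_unit op e by exact: comm_op_unit.
have a112 t : assoc_at op x1 x1 x2 t.
  by apply: (assoc_at_two (u := x1)); rewrite ?neq3.
have a122 t : assoc_at op x1 x2 x2 t.
  by apply: (assoc_at_two (u := x2)); rewrite ?neq3.
have axyx x y t : assoc_at op x y x t.
  rewrite /assoc_at (opC y x).
  by apply: eq_bigr => w _; rewrite (opC x w).
apply/nvalued_assocP => x y z t.
case: (elt3 x) => ->; first by apply: assoc_at_unit opU _; rewrite eqxx.
all: case: (elt3 y) => ->; first by apply: assoc_at_unit opU _; rewrite eqxx orbT.
all: case: (elt3 z) => ->; first by apply: assoc_at_unit opU _; rewrite eqxx !orbT.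
all: by [|apply: axyx | apply: assoc_at_comm opC _].
Qed.

Lemma B1_realized m1 m2 a1 B : 0 < m1 -> 0 < m2 -> is_B1 n m1 m2 a1 B ->
  exists op inv, star_involutive op e inv /\ matrixB op e x1 x2 = B.
Proof.
move=> m1_gt0 m2_gt0 [b1 [a12 [b12 [a2 [b2 [-> [n1 n12 n2] e12 e2]]]]]].
exists (comm_op (sym3 n1) (sym3 n12) (sym3 n2)), id; split; last first.
  by rewrite matrixB_rows !comm_opE /mults /= !mset3E.
set op := comm_op _ _ _.
have opU : nvalued_unit op e by exact: comm_op_unit.
have mult_e x y : (0 < sym_mset (op x y) e) = (y == x).
  by case: (elt3 x) => ->; case: (elt3 y) => ->;
    rewrite ?(opU _).1 ?(opU _).2 /op ?comm_opE ?msetnE /= ?mset3E ?neq3 ?eqxx.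
have opE x y : e \in sym_mset (op x y) <-> y = x.
  by rewrite in_mset mult_e; split=> /eqP.
have opC x y : op x y = op y x by exact: comm_opC.
have opA : nvalued_assoc op.
  (* Associativity at the coefficients other than [e], after cancelling [m1]
     between the two relations. *)
  have b1a2 : a12 * b12 = a2 * b1.
    by apply/eqP; rewrite -(eqn_pmul2l m1_gt0) !mulnA e12 e2 mulnAC.
  by apply: comm_op_assoc; rewrite /assoc_at !sum3 !(opU _).1 !(opU _).2;
    rewrite /op !comm_opE /= !mset3E !msetnE !neq3 ?eqxx; lia.
split=> //.
  by split=> // x; split; apply/opE.
move=> x y; apply/msetP => t; rewrite (mult_map_inv _ _ (inv := id)) //.
by rewrite opC.
Qed.

Lemma B2_realized a B : 2 * a < n -> is_B2 n a B ->
  exists op inv, star_involutive op e inv /\ matrixB op e x1 x2 = B.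
Proof.
move=> a_lt [m [b [-> nm nab nba]]].
exists (comm_op (sym3 nab) (sym3 nm) (sym3 nba)), (tperm x1 x2); split; last first.
  by rewrite matrixB_rows !comm_opE /mults /= !mset3E.
have m_gt0 : 0 < m by lia.
set op := comm_op _ _ _.
have opU : nvalued_unit op e by exact: comm_op_unit.
have tpe : tperm x1 x2 e = e by rewrite tpermD // neq3.
have mult_e x y : (0 < sym_mset (op x y) e) = (y == tperm x1 x2 x).
  by case: (elt3 x) => ->; case: (elt3 y) => ->;
    rewrite ?(opU _).1 ?(opU _).2 /op ?comm_opE ?msetnE /= ?mset3E;
    rewrite ?tpermL ?tpermR ?tpe ?neq3 ?eqxx.
have opE x y : e \in sym_mset (op x y) <-> y = tperm x1 x2 x.
  by rewrite in_mset mult_e; split=> /eqP.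
have opC x y : op x y = op y x by exact: comm_opC.
have opA : nvalued_assoc op.
  by apply: comm_op_assoc; rewrite /assoc_at !sum3 !(opU _).1 !(opU _).2;
    rewrite /op !comm_opE /= !mset3E !msetnE !neq3 ?eqxx; nia.
have opTT x y t : sym_mset (op (tperm x1 x2 x) (tperm x1 x2 y)) t =
                  sym_mset (op x y) (tperm x1 x2 t).
  by case: (elt3 x) => ->; case: (elt3 y) => ->; case: (elt3 t) => ->;
    rewrite ?tpermL ?tpermR ?tpe ?(opU _).1 ?(opU _).2 /op ?comm_opE ?msetnE /=;
    rewrite ?mset3E ?neq3 ?eqxx.
split=> //.
- by split=> // x; split; apply/opE; rewrite ?tpermK.
- exact: tpermK.
- by move=> x; rewrite /inv_mult tpermK opC.
- move=> x y; apply/msetP => t; rewrite mult_map_inv; last exact: tpermK.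
  by rewrite opC opTT.
Qed.

End OrderThree.

Theorem corollary5 (n : nat) (hn : 1 <= n) (X : finType) (hX : #|X| = 3)
    (e x1 x2 : X) (hu : uniq [:: e; x1; x2]) :
  (forall (op : X -> X -> Sym n X) (inv : X -> X),
     star_involutive op e inv ->
     (exists m1 m2 a1 : nat,
        [/\ 0 < m1, 0 < m2 &
            mx_natr (matrixB op e x1 x2) = matrixB1 n m1 m2 a1]) \/
     (exists a1 : nat,
        2 * a1 < n /\ mx_natr (matrixB op e x1 x2) = matrixB2 n a1)) /\
  (forall (m1 m2 a1 : nat) (B : 'M[nat]_(4, 3)),
     0 < m1 -> 0 < m2 -> mx_natr B = matrixB1 n m1 m2 a1 ->
     exists (op : X -> X -> Sym n X) (inv : X -> X),
       star_involutive op e inv /\ matrixB op e x1 x2 = B) /\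
  (forall (a1 : nat) (B : 'M[nat]_(4, 3)),
     2 * a1 < n -> mx_natr B = matrixB2 n a1 ->
     exists (op : X -> X -> Sym n X) (inv : X -> X),
       star_involutive op e inv /\ matrixB op e x1 x2 = B).
Proof.
split=> [op inv opS|]; last split.
- have invK : involutive inv by case: opS.
  case: (elt3 hX hu (inv x1)) => [inv1|inv1|inv1].
  + (* [inv x1 = e] is impossible, since [inv] already sends [e] to [e]. *)
    have := neq3 hu; move: (invK x1); rewrite inv1 (inv_unit hn opS) => ->.
    by rewrite eqxx => -[[[[[]]]]].
  + left; have [m1 [m2 [a1 [m1_gt0 m2_gt0 BE]]]] := star_involutive_B1 hn hX hu opS inv1.
    by exists m1, m2, a1; split=> //; apply/matrixB1P.
  + right; have [a [a_lt BE]] := star_involutive_B2 hn hX hu opS inv1.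
    by exists a; split=> //; apply/matrixB2P.
- move=> m1 m2 a1 B m1_gt0 m2_gt0 /(matrixB1P _ _ _ _ m1_gt0).
  exact: B1_realized.
- by move=> a B a_lt /matrixB2P; apply: B2_realized.
Qed.
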